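(* Let $a\in\mathbb{R}^m$ and $r\in\mathbb{R}^m$, at least one of which is nonzero. Then $$\mu(a,r)=\frac{2|a^Tr|}{\|a+r\|_2+\|a-r\|_2}.$$
   Context: For real matrices $A\in\mathbb{R}^{m\times n}$ and $R\in\mathbb{R}^{m\times d}$ with the same number of rows, define the backward error $$\mu(A,R)=\min_Y\left(\|YY^\dagger A\|_F^2+\|(I-YY^\dagger)R\|_F^2\right)^{1/2},$$ where $Y$ ranges over all real matrices with $m$ rows (any number of columns), $Y^\dagger$ is the Moore-Penrose inverse of $Y$ (so $YY^\dagger$ ranges over all orthogonal projectors on $\mathbb{R}^m$), and $\|\cdot\|_F$ is the Frobenius norm. For vectors $a,r\in\mathbb{R}^m$, $\mu(a,r)$ is defined by viewing $a,r$ as $m\times1$ matrices. *)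

(* Defs.v *)
(* MathComp and MathComp-Analysis *)
From mathcomp Require Import all_boot all_order all_algebra.
From mathcomp Require Import boolp classical_sets reals.

Set Implicit Arguments.
Unset Strict Implicit.
Unset Printing Implicit Defensive.

Import Order.TTheory GRing.Theory Num.Theory.

Local Open Scope classical_set_scope.
Local Open Scope ring_scope.

Definition frobenius_norm (K : realType) (m n : nat) (A : 'M[K]_(m, n)) : K :=
  Num.sqrt (\sum_(i < m) \sum_(j < n) A i j ^+ 2).

Definition euclidean_norm (K : realType) (m : nat) (v : 'cV[K]_m) : K :=
  Num.sqrt (\sum_(i < m) v i 0 ^+ 2).

(* The four Penrose conditions.  The library's pinvmx only satisfies the first
   two in general, hence is not the Moore-Penrose inverse. *)
Definition penrose (K : realType) (m n : nat)
    (Y : 'M[K]_(m, n)) (X : 'M[K]_(n, m)) : Prop :=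
  [/\ Y *m X *m Y = Y,
      X *m Y *m X = X,
      (Y *m X)^T = Y *m X &
      (X *m Y)^T = X *m Y].

(* The default value 0 is never used: see penrose_moore_penrose. *)
Definition moore_penrose (K : realType) (m n : nat)
    (Y : 'M[K]_(m, n)) : 'M[K]_(n, m) :=
  xget 0 [set X | penrose Y X].

Lemma mulmx_tr_eq0 (K : realType) (m n : nat) (A : 'M[K]_(m, n)) :
  A *m A^T = 0 -> A = 0.
Proof.
move=> A0; apply/matrixP => i j; rewrite mxE.
have := congr1 (fun M : 'M_m => M i i) A0; rewrite !mxE => /eqP.
rewrite psumr_eq0 => [/allP/(_ j)|k _]; last by rewrite mxE -expr2 sqr_ge0.
by rewrite mem_index_enum mxE mulf_eq0 orbb => /(_ isT)/eqP.
Qed.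

Lemma gram_unitmx (K : realType) (m n : nat) (B : 'M[K]_(m, n)) :
  row_free B -> B *m B^T \in unitmx.
Proof.
move=> fB; rewrite -row_free_unit -kermx_eq0; apply/eqP.
apply: (row_free_inj fB); rewrite mul0mx; apply: mulmx_tr_eq0.
by rewrite trmx_mul mulmxA -(mulmxA _ B) mulmx_ker mul0mx.
Qed.

Lemma penrose_exists (K : realType) (m n : nat) (Y : 'M[K]_(m, n)) :
  exists X, penrose Y X.
Proof.
have : exists q (C : 'M[K]_(m, q)) (B : 'M[K]_(q, n)),
    [/\ Y = C *m B, B *m B^T \in unitmx & C^T *m C \in unitmx].
  exists (\rank Y), (col_base Y), (row_base Y); split.
  - by rewrite mulmx_base.
  - exact/gram_unitmx/row_base_free.
  - have := @gram_unitmx _ _ _ (col_base Y)^T; rewrite trmxK; apply.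
    by rewrite /row_free mxrank_tr; exact: col_base_full.
case=> q [C] [B] [-> uB uC] {Y}; set Y := C *m B; have YE : Y = C *m B by [].
pose P := invmx (B *m B^T); pose Q := invmx (C^T *m C).
have PT : P^T = P by rewrite /P trmx_inv trmx_mul trmxK.
have QT : Q^T = Q by rewrite /Q trmx_inv trmx_mul trmxK.
pose X := B^T *m P *m Q *m C^T.
have YX : Y *m X = C *m Q *m C^T.
  by rewrite YE /X !mulmxA -(mulmxA C B) -(mulmxA C _ P) mulmxV // mulmx1.
have XY : X *m Y = B^T *m P *m B.
  by rewrite YE /X !mulmxA -(mulmxA _ C^T C) -(mulmxA _ Q) mulVmx // mulmx1.
exists X; split.
- by rewrite YX YE !mulmxA -(mulmxA _ C^T C) -(mulmxA _ Q) mulVmx // mulmx1.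
- by rewrite XY /X !mulmxA -(mulmxA _ B B^T) -(mulmxA _ (B *m _)) mulmxV ?mulmx1.
- by rewrite YX !trmx_mul QT trmxK mulmxA.
- by rewrite XY !trmx_mul PT trmxK mulmxA.
Qed.

Lemma penrose_unique (K : realType) (m n : nat) (Y : 'M[K]_(m, n))
    (X1 X2 : 'M[K]_(n, m)) :
  penrose Y X1 -> penrose Y X2 -> X1 = X2.
Proof.
move=> [a1 b1 c1 d1] [a2 b2 c2 d2].
have YX : Y *m X1 = Y *m X2.
  by rewrite -c1 -{1}a2 -[_ *m Y *m X1]mulmxA trmx_mul c1 c2 mulmxA a1.
have XY : X1 *m Y = X2 *m Y.
  by rewrite -d1 -{1}a2 -mulmxA mulmxA trmx_mul d1 d2 -mulmxA (mulmxA Y) a1.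
by rewrite -b1 XY -mulmxA YX mulmxA b2.
Qed.

Lemma penrose_moore_penrose (K : realType) (m n : nat) (Y : 'M[K]_(m, n)) :
  penrose Y (moore_penrose Y).
Proof. exact: (xgetPex 0 (penrose_exists Y)). Qed.

Definition backward_error_at (K : realType) (m n d k : nat)
    (A : 'M[K]_(m, n)) (R : 'M[K]_(m, d)) (Y : 'M[K]_(m, k)) : K :=
  Num.sqrt (frobenius_norm (Y *m moore_penrose Y *m A) ^+ 2
            + frobenius_norm ((1%:M - Y *m moore_penrose Y) *m R) ^+ 2).

Definition backward_error_values (K : realType) (m n d : nat)
    (A : 'M[K]_(m, n)) (R : 'M[K]_(m, d)) : set K :=
  [set x | exists (k : nat) (Y : 'M[K]_(m, k)), x = backward_error_at A R Y].

Lemma backward_error_values_has_inf (K : realType) (m n d : nat)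
    (A : 'M[K]_(m, n)) (R : 'M[K]_(m, d)) :
  has_inf (backward_error_values A R).
Proof.
split; first by exists (backward_error_at A R (0 : 'M_(m, 0))), 0%N, 0.
by exists 0 => _ [k [Y ->]]; exact: sqrtr_ge0.
Qed.

(* inf is a genuine infimum by backward_error_values_has_inf; it is a minimum
   iff it belongs to backward_error_values A R. *)
Definition backward_error (K : realType) (m n d : nat)
    (A : 'M[K]_(m, n)) (R : 'M[K]_(m, d)) : K :=
  inf (backward_error_values A R).

(* Main.v *)
Require Import Defs.
From mathcomp Require Import all_boot all_order all_algebra.
From mathcomp Require Import boolp classical_sets reals.
From mathcomp Require Import ring lra.

Import Order.TTheory GRing.Theory Num.Theory.

Local Open Scope ring_scope.

(** Put [u = a + r], [v = a - r], and let [s], [t] be their Euclidean norms.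

    For an orthogonal projector [P], Pythagoras turns the objective
    [|P a|^2 + |(1 - P) r|^2] into [|r|^2 + a.Pa - r.Pr], which the symmetry of
    [P] polarises to [|r|^2 + v.Pu]: minimising it is minimising a bilinear
    expression in two fixed vectors.  As [P] is a projector, [Q = 2 P - 1] is an
    isometry, and [v.Pu = (v.u + v.Qu) / 2 >= (v.u - s t) / 2] by Cauchy-Schwarz
    ([projector_dot_ge]).  For nonzero [u] and [v], equality requires [Q] to send
    the direction of [u] to that of [- v]; the reflection fixing the bisector
    [t u - s v] of [u] and [- v] does this, so the projector onto the line of
    that vector is optimal ([projector_dot_bisector]).

    The least value of the squared objective is therefore
    [|r|^2 + (v.u - s t) / 2], which equals [((s - t) / 2)^2] because
    [v.u = |a|^2 - |r|^2] and [s^2 + t^2 = 2 |a|^2 + 2 |r|^2].  Finally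
    [s^2 - t^2 = 4 a.r] rationalises [|s - t| / 2] into the quotient of the
    theorem. *)

Definition dot {K : realType} {m : nat} (x y : 'cV[K]_m) : K :=
  (x^T *m y) 0 0.

Section Dot.
Context {K : realType} {m : nat}.
Implicit Types (x y z : 'cV[K]_m) (c : K).

Lemma dotDl x y z : dot (x + y) z = dot x z + dot y z.
Proof. by rewrite /dot linearD mulmxDl mxE. Qed.

Lemma dotDr x y z : dot x (y + z) = dot x y + dot x z.
Proof. by rewrite /dot mulmxDr mxE. Qed.

Lemma dotNl x y : dot (- x) y = - dot x y.
Proof. by rewrite /dot linearN mulNmx mxE. Qed.

Lemma dotNr x y : dot x (- y) = - dot x y.
Proof. by rewrite /dot mulmxN mxE. Qed.

Lemma dotZl c x y : dot (c *: x) y = c * dot x y.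
Proof. by rewrite /dot linearZ -scalemxAl mxE. Qed.

Lemma dotZr c x y : dot x (c *: y) = c * dot x y.
Proof. by rewrite /dot -scalemxAr mxE. Qed.

Lemma dotC x y : dot x y = dot y x.
Proof. by rewrite /dot -[y^T *m x]trmxK [RHS]mxE trmx_mul trmxK. Qed.

Definition dotE := (dotDl, dotDr, dotNl, dotNr, dotZl, dotZr).

Lemma dot_mulmxr x (M : 'M[K]_m) y : dot x (M *m y) = dot (M^T *m x) y.
Proof. by rewrite /dot trmx_mul trmxK mulmxA. Qed.

Lemma dot_sum_sqr x : dot x x = \sum_(i < m) x i 0 ^+ 2.
Proof. by rewrite /dot mxE; apply: eq_bigr => i _; rewrite mxE expr2. Qed.

Lemma dot_ge0 x : 0 <= dot x x.
Proof. by rewrite dot_sum_sqr sumr_ge0 // => i _; rewrite sqr_ge0. Qed.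

Lemma dot_eq0 x : dot x x = 0 -> x = 0.
Proof.
move=> x0; apply: trmx_inj; rewrite trmx0; apply: mulmx_tr_eq0.
by apply/matrixP => i j; rewrite !ord1 trmxK [RHS]mxE.
Qed.

Lemma euclidean_norm_ge0 x : 0 <= euclidean_norm x.
Proof. exact: sqrtr_ge0. Qed.

Lemma sqr_euclidean_norm x : euclidean_norm x ^+ 2 = dot x x.
Proof. by rewrite /euclidean_norm -dot_sum_sqr sqr_sqrtr ?dot_ge0. Qed.

Lemma sqr_frobenius_norm_col x : frobenius_norm x ^+ 2 = dot x x.
Proof.
have -> : frobenius_norm x = euclidean_norm x.
  by congr Num.sqrt; apply: eq_bigr => i _; rewrite big_ord1.
exact: sqr_euclidean_norm.
Qed.

Lemma euclidean_norm_eq0 x : euclidean_norm x = 0 -> x = 0.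
Proof. by move=> x0; apply: dot_eq0; rewrite -sqr_euclidean_norm x0 expr0n. Qed.

(** Only the lower bound is needed, so the square to expand is that of
    [|y| x + |x| y], which, for nonzero [x] and [y], vanishes exactly when they
    have opposite directions. *)
Lemma cauchy_schwarz_ge x y :
  - (euclidean_norm x * euclidean_norm y) <= dot x y.
Proof.
have [xy0|xy_neq0] := eqVneq (euclidean_norm x * euclidean_norm y) 0.
  rewrite xy0 oppr0; move/eqP: xy0; rewrite mulf_eq0.
  by case/orP=> /eqP/euclidean_norm_eq0 ->;
    rewrite /dot ?trmx0 ?mul0mx ?mulmx0 mxE.
have := dot_ge0 (euclidean_norm y *: x + euclidean_norm x *: y).
rewrite !dotE (dotC y x) -!sqr_euclidean_norm.
have xy_gt0 : 0 < euclidean_norm x * euclidean_norm y.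
  by rewrite lt_neqAle eq_sym xy_neq0 mulr_ge0 ?euclidean_norm_ge0.
move=> ge0; rewrite -(ler_pM2l xy_gt0); nra.
Qed.

End Dot.

Section Projector.
Context {K : realType} {m : nat} {P : 'M[K]_m}.
Hypotheses (Psym : P^T = P) (Pidem : P *m P = P).
Implicit Types a r u v x y : 'cV[K]_m.

Lemma dot_projector x y : dot (P *m x) (P *m y) = dot x (P *m y).
Proof. by rewrite (dot_mulmxr (P *m x)) (dot_mulmxr x) Psym mulmxA Pidem. Qed.

Lemma projector_objective a r :
  dot (P *m a) (P *m a) + dot ((1%:M - P) *m r) ((1%:M - P) *m r) =
  dot r r + dot (a - r) (P *m (a + r)).
Proof.
rewrite mulmxBl mul1mx mulmxDr !dotE !dot_projector.
rewrite (dotC (P *m r) r) (dot_mulmxr r P a) Psym (dotC (P *m r) a); ring.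
Qed.

(** The bound is half of [v.u - |v| |u|], not [- |v| |u|], because Cauchy-Schwarz
    is applied to the reflection [2 P - 1] instead of to [P]. *)
Lemma projector_dot_ge u v :
  (dot v u - euclidean_norm v * euclidean_norm u) / 2 <= dot v (P *m u).
Proof.
(* The isometry [2 P - 1] applied to [u]. *)
pose q := P *m u + P *m u - u.
have q_norm : euclidean_norm q = euclidean_norm u.
  rewrite /euclidean_norm -!dot_sum_sqr; congr Num.sqrt.
  by rewrite /q !dotE !dot_projector (dotC (P *m u) u); ring.
have := cauchy_schwarz_ge v q; rewrite q_norm /q !dotE; lra.
Qed.

End Projector.

Section MoorePenrose.
Variables (K : realType) (m k : nat) (Y : 'M[K]_(m, k)).

Lemma moore_penrose_projector_sym :
  (Y *m moore_penrose Y)^T = Y *m moore_penrose Y.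
Proof. by have [] := penrose_moore_penrose Y. Qed.

Lemma moore_penrose_projector_idem :
  Y *m moore_penrose Y *m (Y *m moore_penrose Y) = Y *m moore_penrose Y.
Proof. by have [YXY _ _ _] := penrose_moore_penrose Y; rewrite mulmxA YXY. Qed.

Lemma backward_error_atE (a r : 'cV[K]_m) :
  backward_error_at a r Y =
  Num.sqrt (dot r r + dot (a - r) (Y *m moore_penrose Y *m (a + r))).
Proof.
rewrite /backward_error_at !sqr_frobenius_norm_col projector_objective //.
  exact: moore_penrose_projector_sym.
exact: moore_penrose_projector_idem.
Qed.

End MoorePenrose.

(** The convention [0^-1 = 0] makes this hold for [y = 0] as well. *)
Lemma moore_penrose_col (K : realType) (m : nat) (y : 'cV[K]_m) :
  moore_penrose y = (dot y y)^-1 *: y^T.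
Proof.
apply: penrose_unique (penrose_moore_penrose y) _.
have [y0|y_neq0] := eqVneq (dot y y) 0.
  rewrite y0 invr0 scale0r (dot_eq0 _ y0).
  by split; rewrite ?mulmx0 ?mul0mx ?trmx0.
have XY : (dot y y)^-1 *: y^T *m y = 1%:M.
  by rewrite -scalemxAl [y^T *m y]mx11_scalar -/(dot y y) scale_scalar_mx mulVf.
split.
- by rewrite -mulmxA XY mulmx1.
- by rewrite XY mul1mx.
- by rewrite -scalemxAr linearZ /= trmx_mul trmxK.
- by rewrite XY trmx1.
Qed.

(** With [p = s t - v.u], the bisector [y] satisfies [y.u = s p], [v.y = - t p]
    and [y.y = 2 s t p], so [(v.y) (y.u) / (y.y) = - p / 2].  If [y.y = 0] the
    projector is zero, and [p = 0] too, because a zero [s] or [t] makes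
    [v.u] vanish. *)
Lemma projector_dot_bisector (K : realType) (m : nat) (u v : 'cV[K]_m) :
  let y := euclidean_norm v *: u - euclidean_norm u *: v in
  dot v (y *m moore_penrose y *m u) =
  (dot v u - euclidean_norm v * euclidean_norm u) / 2.
Proof.
set s := euclidean_norm u; set t := euclidean_norm v => y.
pose p := s * t - dot v u.
have yE z : dot y z = t * dot u z - s * dot v z by rewrite /y !dotE.
have yu : dot y u = s * p.
  by rewrite yE -sqr_euclidean_norm -/s /p; ring.
have vy : dot v y = - (t * p).
  by rewrite dotC yE -sqr_euclidean_norm -/t (dotC u v) /p; ring.
have yy : dot y y = 2 * s * t * p.
  by rewrite yE vy (dotC u y) yu; ring.
have -> : dot v (y *m moore_penrose y *m u) = dot v y * dot y u / dot y y.
  rewrite moore_penrose_col -scalemxAr -scalemxAl dotZr -mulmxA.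
  rewrite [y^T *m u]mx11_scalar -/(dot y u) mul_mx_scalar dotZr; ring.
have [yy0|] := eqVneq (dot y y) 0; last first.
  rewrite yu vy yy !mulf_eq0 !negb_or => /andP[/andP[/andP[_ s0] t0] p0].
  by rewrite -[dot v u](subKr (s * t)) -/p; field; rewrite s0 t0 p0.
suff p0 : p = 0.
  by rewrite yy0 invr0 mulr0 -[dot v u](subKr (s * t)) -/p p0; ring.
move/eqP: yy0; rewrite yy !mulf_eq0 pnatr_eq0 /= -orbA => /or3P[] /eqP // st0.
- rewrite /p (euclidean_norm_eq0 _ st0) st0 mul0r.
  by rewrite /dot mulmx0 mxE subrr.
- rewrite /p (euclidean_norm_eq0 _ st0) st0 mulr0.
  by rewrite /dot trmx0 mul0mx mxE subrr.
Qed.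

Lemma inf_minimum (K : realType) (S : set K) (x : K) :
  S x -> lbound S x -> inf S = x.
Proof.
move=> Sx lbx; apply/eqP; rewrite eq_le; apply/andP; split.
  by apply: ge_inf => //; exists x.
by apply: lb_le_inf => //; exists x.
Qed.

(** For [s = t = 0] both sides vanish, again because [0^-1 = 0]. *)
Lemma rationalize_half_dist (K : realType) (s t b : K) :
  0 <= s -> 0 <= t -> s ^+ 2 - t ^+ 2 = 4 * b ->
  2 * `|b| / (s + t) = `|s - t| / 2.
Proof.
move=> s0 t0 stb.
have [st0|st_neq0] := eqVneq (s + t) 0.
  have [-> ->] : s = 0 /\ t = 0 by split; lra.
  by rewrite subrr addr0 normr0 invr0 mulr0 mul0r.
have -> : b = (s - t) * (s + t) / 4 by rewrite -subr_sqr stb; field.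
rewrite !normrM (ger0_norm (addr_ge0 s0 t0)) normfV normr_nat.
by field.
Qed.

(* The first conjunct says that the minimum defining the backward error is
   attained. *)
Theorem theorem3 (K : realType) (m : nat) (a r : 'cV[K]_m)
    (h : a != 0 \/ r != 0) :
  backward_error_values a r (backward_error a r) /\
  backward_error a r =
    2 * `|(a^T *m r) 0 0| / (euclidean_norm (a + r) + euclidean_norm (a - r)).
Proof.
set u := a + r; set v := a - r.
pose y := euclidean_norm v *: u - euclidean_norm u *: v.
have y_in : backward_error_values a r (backward_error_at a r y).
  by exists 1, y.
have y_min : lbound (backward_error_values a r) (backward_error_at a r y).
  move=> _ [k [Y ->]]; rewrite !backward_error_atE ler_wsqrtr // lerD2l.
  rewrite projector_dot_bisector projector_dot_ge //.
    exact: moore_penrose_projector_sym.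
  exact: moore_penrose_projector_idem.
have errE : backward_error a r = backward_error_at a r y by exact: inf_minimum.
split; first by rewrite errE.
have s2 : euclidean_norm u ^+ 2 = dot a a + dot r r + 2 * dot a r.
  by rewrite sqr_euclidean_norm /u !dotE (dotC r a); ring.
have t2 : euclidean_norm v ^+ 2 = dot a a + dot r r - 2 * dot a r.
  by rewrite sqr_euclidean_norm /v !dotE (dotC r a); ring.
rewrite errE -/(dot a r) (@rationalize_half_dist K _ _ (dot a r));
  rewrite ?euclidean_norm_ge0 ?s2 ?t2 //; last by ring.
rewrite backward_error_atE projector_dot_bisector.
suff -> : dot r r + (dot v u - euclidean_norm v * euclidean_norm u) / 2 =
          ((euclidean_norm u - euclidean_norm v) / 2) ^+ 2.
  by rewrite sqrtr_sqr normrM (@ger0_norm _ 2^-1) // invr_ge0.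
rewrite expr_div_n sqrrB s2 t2 {1}/v {1}/u !dotE (dotC r a).
by field.
Qed.
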